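(* (1) For every étale topological category $C$, the restriction quantal frame $\Omega(C)$ is spatial. (2) For every restriction quantal frame $Q$, the étale topological category $\mathsf{C}(Q)$ is sober.
   Context: A restriction quantal frame is a frame $(Q,\le)$ with associative multiplication distributing over arbitrary joins on both sides, which is a monoid with identity $e$ and carries join-preserving unary operations $a\mapsto a^{\ast}$, $a\mapsto a^{+}$ with values in the set $e^{\downarrow}=\{x:x\le e\}$ of projections (a commutative subsemigroup of idempotents), fixing projections, with $aa^{\ast}=a$, $a^{+}a=a$, $(ab)^{\ast}=(a^{\ast}b)^{\ast}$, $(ab)^{+}=(ab^{+})^{+}$; the top element is a join of partial isometries ($a$ with $b\le a\Rightarrow b=b^{+}a=ab^{\ast}$) and partial isometries are closed under product. Étale topological category: small category with topology making $\mathbf{d}$, $\mathbf{r}$, and multiplication on composable pairs continuous, with $\mathbf{d}$, $\mathbf{r}$ local homeomorphisms. $\Omega(C)$: open subsets of $C$ with $UV=\{uv:u\in U,v\in V,\mathbf{d}(u)=\mathbf{r}(v)\}$, identity the identity space $C_o$, $U^{\ast}=\mathbf{d}(U)$, $U^{+}=\mathbf{r}(U)$. $\mathsf{C}(Q)$: the category of completely prime filters of $Q$ (nonempty, upward closed, closed under binary meets, $0\notin A$, $\bigvee_ia_i\in A\Rightarrow$ some $a_i\in A$) with $\mathbf{d}(A)=(\{a^{\ast}:a\in A\})^{\uparrow}$, $\mathbf{r}(A)=(\{a^{+}:a\in A\})^{\uparrow}$, $A\cdot B=(AB)^{\uparrow}$ when $\mathbf{d}(A)=\mathbf{r}(B)$,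 topology with base $\mathscr{X}_a=\{A:a\in A\}$, $a$ a partial isometry. $Q$ is spatial if $\chi\colon Q\to\Omega(\mathsf{C}(Q))$, $a\mapsto\mathscr{X}_a$, is an isomorphism; $C$ is sober if $\omega\colon C\to\mathsf{C}(\Omega(C))$, $x\mapsto\{\text{open sets containing }x\}$, is an isomorphism of categories and a homeomorphism. *)

(* Defs.v *)
From Stdlib Require Import Classical ClassicalEpsilon FunctionalExtensionality
  PropExtensionality ProofIrrelevance.

Definition is_topology {X : Type} (O : (X -> Prop) -> Prop) : Prop :=
  (forall F : (X -> Prop) -> Prop, (forall U, F U -> O U) ->
      O (fun x => exists U, F U /\ U x)) /\
  (forall U V, O U -> O V -> O (fun x => U x /\ V x)) /\
  O (fun _ => True).

Definition gen_topology {X : Type} (B : (X -> Prop) -> Prop) : (X -> Prop) -> Prop :=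
  fun S => forall O, is_topology O -> (forall U, B U -> O U) -> O S.

Lemma gen_topology_is_topology {X : Type} (B : (X -> Prop) -> Prop) :
  is_topology (gen_topology B).
Proof.
  split; [|split].
  - intros F HF O HO HB. apply (proj1 HO). intros U HU. exact (HF U HU O HO HB).
  - intros U V HU HV O HO HB.
    apply (proj1 (proj2 HO)); [apply HU|apply HV]; auto.
  - intros O HO HB. exact (proj2 (proj2 HO)).
Qed.

(* A small category given by its set of arrows [tc_car] with domain [tc_d]
   and range [tc_r] (identities are the arrows x with d x = x) and the
   composition relation [tc_mul x y z] meaning "z = x y" (defined only for
   composable pairs, see [is_category]); together with a topology. *)
Record TopCat := {
  tc_car : Type;
  tc_open : (tc_car -> Prop) -> Prop;
  tc_open_top : is_topology tc_open;
  tc_d : tc_car -> tc_car;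
  tc_r : tc_car -> tc_car;
  tc_mul : tc_car -> tc_car -> tc_car -> Prop
}.

Lemma tc_open_empty (C : TopCat) : tc_open C (fun _ => False).
Proof.
  destruct (tc_open_top C) as [H1 _].
  assert (E : (fun _ : tc_car C => False) =
              (fun x => exists U, (fun _ : tc_car C -> Prop => False) U /\ U x)).
  { apply functional_extensionality; intro x; apply propositional_extensionality.
    split; [intros []|intros [U [[] _]]]. }
  rewrite E. apply H1. intros U [].
Qed.

Definition is_category (C : TopCat) : Prop :=
  let d := tc_d C in let r := tc_r C in let m := tc_mul C in
  (forall x, d (d x) = d x /\ r (d x) = d x /\ d (r x) = r x /\ r (r x) = r x) /\
  (forall x y z, m x y z -> d x = r y) /\
  (forall x y, d x = r y -> exists z, m x y z) /\
  (forall x y z z', m x y z -> m x y z' -> z = z') /\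
  (forall x y z, m x y z -> d z = d y /\ r z = r x) /\
  (forall x, m x (d x) x /\ m (r x) x x) /\
  (forall x y w u v, m x y u -> m u w v -> exists t, m y w t /\ m x t v) /\
  (forall x y w t v, m y w t -> m x t v -> exists u, m x y u /\ m u w v).

Definition tc_continuous (C : TopCat) (f : tc_car C -> tc_car C) : Prop :=
  forall V, tc_open C V -> tc_open C (fun x => V (f x)).

(* f : C -> C is a local homeomorphism: continuous, and every point has an
   open neighbourhood U on which f is injective and maps opens contained in U
   to opens (i.e. f|U is a homeomorphism onto the open set f(U)). *)
Definition tc_local_homeo (C : TopCat) (f : tc_car C -> tc_car C) : Prop :=
  tc_continuous C f /\
  forall x, exists U, tc_open C U /\ U x /\
    (forall y z, U y -> U z -> f y = f z -> y = z) /\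
    (forall V, tc_open C V -> (forall y, V y -> U y) ->
       tc_open C (fun w => exists y, V y /\ w = f y)).

(* continuity of multiplication on the space of composable pairs
   (subspace of the product topology) *)
Definition tc_mul_continuous (C : TopCat) : Prop :=
  forall W, tc_open C W -> forall x y z, tc_mul C x y z -> W z ->
    exists U V, tc_open C U /\ tc_open C V /\ U x /\ V y /\
      (forall u v w, U u -> V v -> tc_mul C u v w -> W w).

Definition is_etale (C : TopCat) : Prop :=
  is_category C /\
  tc_continuous C (tc_d C) /\ tc_continuous C (tc_r C) /\
  tc_mul_continuous C /\
  tc_local_homeo C (tc_d C) /\ tc_local_homeo C (tc_r C).

Record QF := {
  q_car : Type;
  q_le : q_car -> q_car -> Prop;
  q_mul : q_car -> q_car -> q_car;
  q_e : q_car;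
  q_star : q_car -> q_car;
  q_plus : q_car -> q_car
}.

Section QFdefs.
Variable Q : QF.
Local Notation le := (q_le Q).
Local Notation mul := (q_mul Q).
Local Notation e := (q_e Q).
Local Notation star := (q_star Q).
Local Notation plus := (q_plus Q).

Definition is_lub (S : q_car Q -> Prop) (j : q_car Q) : Prop :=
  (forall s, S s -> le s j) /\ (forall u, (forall s, S s -> le s u) -> le j u).

Definition is_meet (a b m : q_car Q) : Prop :=
  le m a /\ le m b /\ (forall u, le u a -> le u b -> le u m).

Definition partial_isometry (a : q_car Q) : Prop :=
  forall b, le b a -> b = mul (plus b) a /\ b = mul a (star b).

Definition is_RQF : Prop :=
  (forall a, le a a) /\
  (forall a b c, le a b -> le b c -> le a c) /\
  (forall a b, le a b -> le b a -> a = b) /\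
  (forall S, exists j, is_lub S j) /\
  (forall a S j m, is_lub S j -> is_meet a j m ->
      is_lub (fun x => exists s, S s /\ is_meet a s x) m) /\
  (forall a b c, mul (mul a b) c = mul a (mul b c)) /\
  (forall a, mul e a = a /\ mul a e = a) /\
  (forall a S j, is_lub S j ->
      is_lub (fun x => exists s, S s /\ x = mul a s) (mul a j) /\
      is_lub (fun x => exists s, S s /\ x = mul s a) (mul j a)) /\
  (forall S j, is_lub S j ->
      is_lub (fun x => exists s, S s /\ x = star s) (star j) /\
      is_lub (fun x => exists s, S s /\ x = plus s) (plus j)) /\
  (forall a, le (star a) e /\ le (plus a) e) /\
  (forall p, le p e -> star p = p /\ plus p = p) /\
  (forall p q, le p e -> le q e -> le (mul p q) e /\ mul p q = mul q p /\ mul p p = p) /\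
  (forall a, mul a (star a) = a /\ mul (plus a) a = a) /\
  (forall a b, star (mul a b) = star (mul (star a) b) /\
               plus (mul a b) = plus (mul a (plus b))) /\
  (forall t, (forall x, le x t) -> is_lub partial_isometry t) /\
  (forall a b, partial_isometry a -> partial_isometry b -> partial_isometry (mul a b)).

Definition is_cpfilter (A : q_car Q -> Prop) : Prop :=
  (exists a, A a) /\
  (forall a b, A a -> le a b -> A b) /\
  (forall a b m, A a -> A b -> is_meet a b m -> A m) /\
  (forall z, (forall x, le z x) -> ~ A z) /\
  (forall S j, is_lub S j -> A j -> exists s, S s /\ A s).

Definition cpf : Type := { A : q_car Q -> Prop | is_cpfilter A }.

Definition upclose (S : q_car Q -> Prop) : q_car Q -> Prop :=
  fun x => exists s, S s /\ le s x.

(* S as a completely prime filter when it is one (junk value dflt otherwise;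
   for a restriction quantal frame the junk branch is never used) *)
Definition mkcpf (S : q_car Q -> Prop) (dflt : cpf) : cpf :=
  match excluded_middle_informative (is_cpfilter S) with
  | left H => exist _ S H
  | right _ => dflt
  end.

Definition cpf_d (A : cpf) : cpf :=
  mkcpf (upclose (fun x => exists a, proj1_sig A a /\ x = star a)) A.
Definition cpf_r (A : cpf) : cpf :=
  mkcpf (upclose (fun x => exists a, proj1_sig A a /\ x = plus a)) A.
Definition cpf_mul (A B Z : cpf) : Prop :=
  cpf_d A = cpf_r B /\
  proj1_sig Z = upclose (fun x => exists a b, proj1_sig A a /\ proj1_sig B b /\ x = mul a b).

Definition Xset (a : q_car Q) : cpf -> Prop := fun A => proj1_sig A a.

End QFdefs.

Definition Ccat (Q : QF) : TopCat := {|
  tc_car := cpf Q;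
  tc_open := gen_topology (fun S => exists a, partial_isometry Q a /\ S = Xset Q a);
  tc_open_top := gen_topology_is_topology _;
  tc_d := cpf_d Q;
  tc_r := cpf_r Q;
  tc_mul := cpf_mul Q
|}.

Definition opens (C : TopCat) : Type := { U : tc_car C -> Prop | tc_open C U }.

(* S as an open set when it is open (junk: the empty set otherwise; for an
   etale category the junk branch is never used) *)
Definition mkopen (C : TopCat) (S : tc_car C -> Prop) : opens C :=
  match excluded_middle_informative (tc_open C S) with
  | left H => exist _ S H
  | right _ => exist _ (fun _ => False) (tc_open_empty C)
  end.

Definition Omega (C : TopCat) : QF := {|
  q_car := opens C;
  q_le := fun U V => forall x, proj1_sig U x -> proj1_sig V x;
  q_mul := fun U V => mkopen C (fun z => exists u v, proj1_sig U u /\ proj1_sig V v /\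
                                     tc_d C u = tc_r C v /\ tc_mul C u v z);
  q_e := mkopen C (fun x => tc_d C x = x);
  q_star := fun U => mkopen C (fun y => exists x, proj1_sig U x /\ y = tc_d C x);
  q_plus := fun U => mkopen C (fun y => exists x, proj1_sig U x /\ y = tc_r C x)
|}.

Definition QF_iso (Q1 Q2 : QF) (f : q_car Q1 -> q_car Q2) : Prop :=
  (forall a b, f a = f b -> a = b) /\
  (forall y, exists x, f x = y) /\
  (forall a b, q_le Q1 a b <-> q_le Q2 (f a) (f b)) /\
  (forall a b, f (q_mul Q1 a b) = q_mul Q2 (f a) (f b)) /\
  f (q_e Q1) = q_e Q2 /\
  (forall a, f (q_star Q1 a) = q_star Q2 (f a)) /\
  (forall a, f (q_plus Q1 a) = q_plus Q2 (f a)).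

Definition cat_iso (C1 C2 : TopCat) (f : tc_car C1 -> tc_car C2) : Prop :=
  (forall x y, f x = f y -> x = y) /\
  (forall y, exists x, f x = y) /\
  (forall x, f (tc_d C1 x) = tc_d C2 (f x)) /\
  (forall x, f (tc_r C1 x) = tc_r C2 (f x)) /\
  (forall x y z, tc_mul C1 x y z <-> tc_mul C2 (f x) (f y) (f z)).

Definition homeo (C1 C2 : TopCat) (f : tc_car C1 -> tc_car C2) : Prop :=
  (forall x y, f x = f y -> x = y) /\
  (forall y, exists x, f x = y) /\
  (forall V, tc_open C2 V -> tc_open C1 (fun x => V (f x))) /\
  (forall U, tc_open C1 U -> tc_open C2 (fun y => exists x, U x /\ y = f x)).

Definition spatial (Q : QF) : Prop :=
  exists chi : q_car Q -> q_car (Omega (Ccat Q)),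
    (forall a, proj1_sig (chi a) = Xset Q a) /\
    QF_iso Q (Omega (Ccat Q)) chi.

Definition sober (C : TopCat) : Prop :=
  exists om : tc_car C -> tc_car (Ccat (Omega C)),
    (forall x, proj1_sig (om x) = (fun U : opens C => proj1_sig U x)) /\
    cat_iso C (Ccat (Omega C)) om /\
    homeo C (Ccat (Omega C)) om.

(* Main.v *)
Require Import Defs.
From Stdlib Require Import ClassicalEpsilon FunctionalExtensionality
  PropExtensionality ProofIrrelevance.

(* Both halves come from one development about a "based restriction frame":
   a frame Q satisfying the restriction quantal frame axioms other than those
   on partial isometries, together with a base P of partial isometries
   (downward closed, closed under products, with join the top element).  For
   such Q we show that the open sets of the space C(Q) of completely prime
   filters are exactly the basic sets X_a, and that a |-> X_a turns products,
   domains, ranges and the unit of Q into those of Omega(C(Q)); the key step is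
   that a filter containing a product a b is the product of composable filters
   containing a and b.  Consequently (a) Q is spatial as soon as its points
   separate its elements, and (b) C(Q) is sober.  A restriction quantal frame is
   based on its partial isometries, which gives part (2).  For an etale
   category C, Omega(C) is a restriction frame based on its open bisections,
   and neighbourhood filters separate open sets, which gives part (1). *)

Record restriction_frame (Q : QF) : Prop := {
  rf_refl : forall a, q_le Q a a;
  rf_trans : forall a b c, q_le Q a b -> q_le Q b c -> q_le Q a c;
  rf_antisym : forall a b, q_le Q a b -> q_le Q b a -> a = b;
  rf_lub : forall S, exists j, is_lub Q S j;
  rf_distr : forall a S j m, is_lub Q S j -> is_meet Q a j m ->
      is_lub Q (fun x => exists s, S s /\ is_meet Q a s x) m;
  rf_assoc : forall a b c, q_mul Q (q_mul Q a b) c = q_mul Q a (q_mul Q b c);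
  rf_unit : forall a, q_mul Q (q_e Q) a = a /\ q_mul Q a (q_e Q) = a;
  rf_mul_lub : forall a S j, is_lub Q S j ->
      is_lub Q (fun x => exists s, S s /\ x = q_mul Q a s) (q_mul Q a j) /\
      is_lub Q (fun x => exists s, S s /\ x = q_mul Q s a) (q_mul Q j a);
  rf_dr_lub : forall S j, is_lub Q S j ->
      is_lub Q (fun x => exists s, S s /\ x = q_star Q s) (q_star Q j) /\
      is_lub Q (fun x => exists s, S s /\ x = q_plus Q s) (q_plus Q j);
  rf_dr_proj : forall a, q_le Q (q_star Q a) (q_e Q) /\ q_le Q (q_plus Q a) (q_e Q);
  rf_proj_fixed : forall p, q_le Q p (q_e Q) -> q_star Q p = p /\ q_plus Q p = p;
  rf_proj_comm : forall p q, q_le Q p (q_e Q) -> q_le Q q (q_e Q) ->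
      q_le Q (q_mul Q p q) (q_e Q) /\ q_mul Q p q = q_mul Q q p /\ q_mul Q p p = p;
  rf_restr : forall a, q_mul Q a (q_star Q a) = a /\ q_mul Q (q_plus Q a) a = a;
  rf_dr_mul : forall a b, q_star Q (q_mul Q a b) = q_star Q (q_mul Q (q_star Q a) b) /\
      q_plus Q (q_mul Q a b) = q_plus Q (q_mul Q a (q_plus Q b))
}.

(* The partial isometries
   themselves form a base; for Omega(C) the open bisections do. *)
Record frame_base (Q : QF) (P : q_car Q -> Prop) : Prop := {
  base_pi : forall a, P a -> partial_isometry Q a;
  base_down : forall a b, P a -> q_le Q b a -> P b;
  base_mul : forall a b, P a -> P b -> P (q_mul Q a b);
  base_top : forall t, (forall x, q_le Q x t) -> is_lub Q P t
}.

Lemma pred_ext {X : Type} (f g : X -> Prop) : (forall x, f x <-> g x) -> f = g.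
Proof.
  intros H. apply functional_extensionality; intros x.
  apply propositional_extensionality; auto.
Qed.

Lemma gen_basic {X : Type} (B : (X -> Prop) -> Prop) S : B S -> gen_topology B S.
Proof. intros H O _ HB. auto. Qed.

Definition is_bottom {Q : QF} (z : q_car Q) : Prop := forall x, q_le Q z x.

Section CompletelyPrimeFilter.
Context {Q : QF} (A : q_car Q -> Prop) (HA : is_cpfilter Q A).

Lemma filter_nonempty : exists a, A a.
Proof. apply HA. Qed.
Lemma filter_up a b : A a -> q_le Q a b -> A b.
Proof. apply HA. Qed.
Lemma filter_not_bottom z : A z -> ~ is_bottom z.
Proof. intros Hz Hb. apply (proj1 (proj2 (proj2 (proj2 HA))) z Hb Hz). Qed.
Lemma filter_prime S j : is_lub Q S j -> A j -> exists s, S s /\ A s.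
Proof. apply HA. Qed.
End CompletelyPrimeFilter.

Lemma cpf_eq {Q : QF} (A B : cpf Q) : proj1_sig A = proj1_sig B -> A = B.
Proof.
  destruct A as [A HA], B as [B HB]; simpl; intros ->. f_equal. apply proof_irrelevance.
Qed.

Lemma mkcpf_eq {Q : QF} S (A dflt : cpf Q) : S = proj1_sig A -> mkcpf Q S dflt = A.
Proof.
  intros ->. unfold mkcpf. destruct excluded_middle_informative as [H|H].
  - apply cpf_eq. reflexivity.
  - exfalso. apply H, proj2_sig.
Qed.

Section OpenSets.
Context {C : TopCat}.
Local Notation op := (tc_open C).

Lemma mkopen_eq S : op S -> proj1_sig (mkopen C S) = S.
Proof.
  intros H. unfold mkopen.
  destruct excluded_middle_informative; [reflexivity | contradiction].
Qed.

Lemma opens_eq (U V : opens C) : (forall x, proj1_sig U x <-> proj1_sig V x) -> U = V.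
Proof.
  destruct U as [U HU], V as [V HV]; simpl; intros H.
  assert (E : U = V) by (apply pred_ext; auto). subst V. f_equal. apply proof_irrelevance.
Qed.

Lemma open_union (F : (tc_car C -> Prop) -> Prop) : (forall U, F U -> op U) ->
  op (fun x => exists U, F U /\ U x).
Proof. apply (proj1 (tc_open_top C)). Qed.
Lemma open_inter U V : op U -> op V -> op (fun x => U x /\ V x).
Proof. apply (proj1 (proj2 (tc_open_top C))). Qed.
Lemma open_full : op (fun _ => True).
Proof. apply (proj2 (proj2 (tc_open_top C))). Qed.
Lemma open_ext S T : (forall x, S x <-> T x) -> op S -> op T.
Proof. intros H HS. replace T with S; auto. apply pred_ext; auto. Qed.

Definition union_of (S : opens C -> Prop) : tc_car C -> Prop :=
  fun x => exists V, S V /\ proj1_sig V x.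

Lemma union_of_open S : op (union_of S).
Proof.
  apply (open_ext (fun x => exists U, (fun U => exists V, S V /\ U = proj1_sig V) U /\ U x)).
  - intros x. split.
    + intros [U [[V [HV ->]] Hx]]. exists V. auto.
    + intros [V [HV Hx]]. exists (proj1_sig V). eauto.
  - apply open_union. intros U [V [_ ->]]. apply proj2_sig.
Qed.

Lemma Omega_lub S j : is_lub (Omega C) S j <-> forall x, proj1_sig j x <-> union_of S x.
Proof.
  split.
  - intros [H1 H2] x. split.
    + apply (H2 (exist _ (union_of S) (union_of_open S))). intros s Hs y Hy. exists s; auto.
    + intros [V [HV Hx]]. apply (H1 V HV); auto.
  - intros H. split.
    + intros s Hs x Hx. apply H. exists s; auto.
    + intros u Hu x Hx. apply H in Hx. destruct Hx as [V [HV Hx]]. apply (Hu V HV); auto.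
Qed.

Lemma Omega_meet a b m :
  is_meet (Omega C) a b m <-> forall x, proj1_sig m x <-> proj1_sig a x /\ proj1_sig b x.
Proof.
  split.
  - intros [H1 [H2 H3]] x. split.
    + intros Hx. split; [apply H1 | apply H2]; auto.
    + intros Hab. apply (H3 (exist _ _ (open_inter _ _ (proj2_sig a) (proj2_sig b))));
        simpl; tauto.
  - intros H. split; [|split].
    + intros x Hx; apply H; auto.
    + intros x Hx; apply H; auto.
    + intros u H1 H2 x Hx. apply H. simpl in *. auto.
Qed.

Definition full_open : opens C := exist _ (fun _ => True) open_full.
Definition empty_open : opens C := exist _ (fun _ => False) (tc_open_empty C).

Definition nbhd_filter (x : tc_car C) : opens C -> Prop := fun U => proj1_sig U x.

Lemma nbhd_cpfilter x : is_cpfilter (Omega C) (nbhd_filter x).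
Proof.
  split; [|split; [|split; [|split]]].
  - exists full_open. simpl. auto.
  - intros a b Ha Hab. apply Hab. auto.
  - intros a b m Ha Hb Hm. apply (proj1 (Omega_meet a b m) Hm). split; auto.
  - intros z Hz Hx. apply (Hz empty_open x Hx).
  - intros S j Hj Hx. apply (proj1 (Omega_lub S j) Hj) in Hx.
    destruct Hx as [V [HV Hx]]. eauto.
Qed.

Lemma Omega_antisym (U V : opens C) : q_le (Omega C) U V -> q_le (Omega C) V U -> U = V.
Proof. intros H1 H2. apply opens_eq. intros x; split; auto. Qed.

Lemma Omega_lub_exists S : exists j, is_lub (Omega C) S j.
Proof.
  exists (exist _ (union_of S) (union_of_open S)). apply Omega_lub. intros x; simpl; tauto.
Qed.

Lemma Omega_distr a S j m : is_lub (Omega C) S j -> is_meet (Omega C) a j m ->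
  is_lub (Omega C) (fun x => exists s, S s /\ is_meet (Omega C) a s x) m.
Proof.
  intros Hj Hm. apply Omega_lub. intros x.
  rewrite (proj1 (Omega_meet a j m) Hm x), (proj1 (Omega_lub S j) Hj x). split.
  - intros [Ha [V [HV Hx]]].
    exists (exist _ _ (open_inter _ _ (proj2_sig a) (proj2_sig V))).
    split; [|simpl; auto]. exists V. split; auto. apply Omega_meet. intros y; simpl; tauto.
  - intros [V [[s [Hs HV]] Hx]]. rewrite (proj1 (Omega_meet a s V) HV x) in Hx.
    destruct Hx as [Ha Hs']. split; auto. exists s; auto.
Qed.

End OpenSets.

Section RestrictionFrame.
Variable Q : QF.
Hypothesis HQ : restriction_frame Q.
Local Notation le := (q_le Q).
Local Notation mul := (q_mul Q).
Local Notation e := (q_e Q).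
Local Notation st := (q_star Q).
Local Notation pl := (q_plus Q).

Let Hrefl := rf_refl Q HQ.
Let Htrans := rf_trans Q HQ.
Let Hanti := rf_antisym Q HQ.
Let Hlub := rf_lub Q HQ.
Let Hdistr := rf_distr Q HQ.
Let Hassoc := rf_assoc Q HQ.
Let Hunit := rf_unit Q HQ.
Let Hmul_lub := rf_mul_lub Q HQ.
Let Hdr_lub := rf_dr_lub Q HQ.
Let Hdr_proj := rf_dr_proj Q HQ.
Let Hfix := rf_proj_fixed Q HQ.
Let Hproj := rf_proj_comm Q HQ.
Let Hres1 := rf_restr Q HQ.
Let Hres2 := rf_dr_mul Q HQ.

Definition preserves_joins (g : q_car Q -> q_car Q) : Prop :=
  forall S j, is_lub Q S j -> is_lub Q (fun x => exists s, S s /\ x = g s) (g j).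

Lemma lub_pair a b : le a b -> is_lub Q (fun x => x = a \/ x = b) b.
Proof. intros H; split; [intros s [-> | ->]; auto | intros u Hu; apply Hu; auto]. Qed.

Lemma lub_empty z : is_bottom z -> is_lub Q (fun _ => False) z.
Proof. intros H; split; [intros _ [] | intros; apply H]. Qed.

Lemma joins_monotone g : preserves_joins g -> forall a b, le a b -> le (g a) (g b).
Proof. intros Hg a b H. apply (proj1 (Hg _ _ (lub_pair a b H))). eauto. Qed.

Lemma joins_bottom g z : preserves_joins g -> is_bottom z -> is_bottom (g z).
Proof. intros Hg Hz x. apply (proj2 (Hg _ _ (lub_empty z Hz))). intros s [t [[] _]]. Qed.

Lemma mul_l_joins a : preserves_joins (mul a).
Proof. intros S j Hj. apply (Hmul_lub a S j Hj). Qed.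
Lemma mul_r_joins a : preserves_joins (fun x => mul x a).
Proof. intros S j Hj. apply (Hmul_lub a S j Hj). Qed.
Lemma star_joins : preserves_joins st.
Proof. intros S j Hj. apply (Hdr_lub S j Hj). Qed.
Lemma plus_joins : preserves_joins pl.
Proof. intros S j Hj. apply (Hdr_lub S j Hj). Qed.

Lemma mul_monoL a b c : le a b -> le (mul c a) (mul c b).
Proof. apply joins_monotone, mul_l_joins. Qed.
Lemma mul_monoR a b c : le a b -> le (mul a c) (mul b c).
Proof. apply (joins_monotone _ (mul_r_joins c)). Qed.
Lemma mul_mono a b c d : le a b -> le c d -> le (mul a c) (mul b d).
Proof. intros; eapply Htrans; [apply mul_monoR | apply mul_monoL]; eauto. Qed.
Lemma star_mono a b : le a b -> le (st a) (st b).
Proof. apply joins_monotone, star_joins. Qed.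
Lemma plus_mono a b : le a b -> le (pl a) (pl b).
Proof. apply joins_monotone, plus_joins. Qed.

Lemma top_exists : exists t, forall x, le x t.
Proof. destruct (Hlub (fun _ => True)) as [t [H _]]. exists t; auto. Qed.

Lemma meet_exists a b : exists m, is_meet Q a b m.
Proof.
  destruct (Hlub (fun x => le x a /\ le x b)) as [m [H1 H2]].
  exists m. split; [|split].
  - apply H2. intros s [? ?]; auto.
  - apply H2. intros s [? ?]; auto.
  - intros u Hu1 Hu2. apply H1; auto.
Qed.

Lemma meet_le_l a b m : is_meet Q a b m -> le m a.
Proof. intros [? _]; auto. Qed.
Lemma meet_of_le a j : le a j -> is_meet Q a j a.
Proof. intros H; split; [|split]; auto. Qed.

Lemma mul_proj_le_r a p : le p e -> le (mul a p) a.
Proof. intros H. rewrite <- (proj2 (Hunit a)) at 2. apply mul_monoL; auto. Qed.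
Lemma mul_proj_le_l a p : le p e -> le (mul p a) a.
Proof. intros H. rewrite <- (proj1 (Hunit a)) at 2. apply mul_monoR; auto. Qed.

Lemma proj_le p q : le p e -> le q e -> le p q -> mul p q = p /\ mul q p = p.
Proof.
  intros Hp Hq H. destruct (Hproj p q Hp Hq) as [_ [Hc _]].
  assert (E : mul p q = p).
  { apply Hanti.
    - rewrite Hc. apply mul_proj_le_l; auto.
    - rewrite <- (proj2 (proj2 (Hproj p p Hp Hp))) at 1. apply mul_monoL; auto. }
  split; congruence.
Qed.

Lemma proj_meet p q : le p e -> le q e -> is_meet Q p q (mul p q).
Proof.
  intros Hp Hq. split; [|split].
  - apply mul_proj_le_r; auto.
  - rewrite (proj1 (proj2 (Hproj p q Hp Hq))). apply mul_proj_le_r; auto.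
  - intros u H1 H2. assert (Hu : le u e) by eauto.
    rewrite <- (proj2 (proj2 (Hproj u u Hu Hu))). apply mul_mono; auto.
Qed.

Lemma proj_mul_fixed p q : le p e -> le q e -> st (mul p q) = mul p q /\ pl (mul p q) = mul p q.
Proof. intros Hp Hq. apply Hfix, (Hproj p q Hp Hq). Qed.

Lemma star_restrict a p : le p (st a) -> st (mul a p) = p.
Proof.
  intros Hp. assert (Hpe : le p e) by (eapply Htrans; eauto; apply Hdr_proj).
  rewrite (proj1 (Hres2 a p)), (proj1 (proj_mul_fixed _ _ (proj1 (Hdr_proj a)) Hpe)).
  apply (proj_le p (st a)); auto; apply Hdr_proj.
Qed.
Lemma plus_restrict a p : le p (pl a) -> pl (mul p a) = p.
Proof.
  intros Hp. assert (Hpe : le p e) by (eapply Htrans; eauto; apply Hdr_proj).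
  rewrite (proj2 (Hres2 p a)), (proj2 (proj_mul_fixed _ _ Hpe (proj2 (Hdr_proj a)))).
  apply (proj_le p (pl a)); auto; apply Hdr_proj.
Qed.

Lemma star_mul_le a b : le (st (mul a b)) (st b).
Proof.
  rewrite (proj1 (Hres2 a b)). apply star_mono, mul_proj_le_l, Hdr_proj.
Qed.
Lemma plus_mul_le a b : le (pl (mul a b)) (pl a).
Proof.
  rewrite (proj2 (Hres2 a b)). apply plus_mono, mul_proj_le_r, Hdr_proj.
Qed.

(* Below a partial isometry the order is restriction; hence partial
   isometries are downward closed. *)
Lemma partial_isometry_down a b : partial_isometry Q a -> le b a -> partial_isometry Q b.
Proof.
  intros Ha Hba d Hdb.
  destruct (Ha d (Htrans _ _ _ Hdb Hba)) as [E1 E2]. destruct (Ha b Hba) as [F1 F2].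
  split.
  - rewrite F1, <- Hassoc.
    rewrite (proj1 (proj_le _ _ (proj2 (Hdr_proj d)) (proj2 (Hdr_proj b)) (plus_mono _ _ Hdb))).
    exact E1.
  - rewrite F2, Hassoc.
    rewrite (proj2 (proj_le _ _ (proj1 (Hdr_proj d)) (proj1 (Hdr_proj b)) (star_mono _ _ Hdb))).
    exact E2.
Qed.

Lemma filter_lower A (HA : is_cpfilter Q A) a b : A a -> A b -> exists m, A m /\ le m a /\ le m b.
Proof.
  intros Ha Hb. destruct (meet_exists a b) as [m Hm]. exists m.
  split; [apply (proj1 (proj2 (proj2 HA)) a b m Ha Hb Hm) | split; apply Hm].
Qed.

(* All filters on
   Q constructed below (domains, ranges, factors, translates) are of this form. *)
Lemma image_cpfilter (Y D : q_car Q -> Prop) (f : q_car Q -> q_car Q)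
    (g : q_car Q -> q_car Q -> q_car Q) :
  is_cpfilter Q Y ->
  (exists y, Y y /\ D y) ->
  (forall y y', D y -> le y' y -> D y') ->
  (forall y y', le y y' -> le (f y) (f y')) ->
  (forall y, Y y -> D y -> preserves_joins (g y) /\ g y (f y) = y /\
      forall w, le w (f y) -> D (g y w) /\ le (f (g y w)) w) ->
  is_cpfilter Q (upclose Q (fun x => exists y, Y y /\ D y /\ x = f y)).
Proof.
  intros HY [y0 [Yy0 Dy0]] Ddown Fmono Hg. split; [|split; [|split; [|split]]].
  - exists (f y0), (f y0). split; eauto.
  - intros a b [x [Hx Hxa]] Hab. exists x. split; eauto.
  - intros a b m [x1 [[y1 [Y1 [D1 ->]]] H1]] [x2 [[y2 [Y2 [D2 ->]]] H2]] Hm.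
    destruct (filter_lower Y HY y1 y2 Y1 Y2) as [y [Yy [Hy1 Hy2]]].
    exists (f y). split; [exists y; eauto |].
    apply Hm; eapply Htrans; eauto.
  - intros z Hz [x [[y [Yy [Dy ->]]] Hyz]].
    destruct (Hg y Yy Dy) as [Hjoin [Hgy _]].
    apply (filter_not_bottom Y HY y Yy). intros u.
    rewrite <- Hgy. eapply Htrans; [apply (joins_monotone _ Hjoin _ _ Hyz) |].
    apply (joins_bottom _ _ Hjoin Hz).
  - intros S j Hj [x [[y [Yy [Dy ->]]] Hyj]].
    destruct (Hg y Yy Dy) as [Hjoin [Hgy Hback]].
    pose proof (Hjoin _ _ (Hdistr (f y) S j (f y) Hj (meet_of_le _ _ Hyj))) as HL.
    rewrite Hgy in HL.
    destruct (filter_prime Y HY _ _ HL Yy) as [u [[w [[s [Hs Hw]] ->]] Hu]].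
    exists s. split; auto.
    destruct (Hback w (meet_le_l _ _ _ Hw)) as [Dgw Hfw].
    exists (f (g y w)). split; [eauto | eapply Htrans; [exact Hfw | apply Hw]].
Qed.

Definition Dset (A : q_car Q -> Prop) := upclose Q (fun x => exists a, A a /\ x = st a).
Definition Rset (A : q_car Q -> Prop) := upclose Q (fun x => exists a, A a /\ x = pl a).

Lemma image_as_restricted (A : q_car Q -> Prop) (f : q_car Q -> q_car Q) :
  (fun x => exists a, A a /\ x = f a) = (fun x => exists a, A a /\ True /\ x = f a).
Proof. apply pred_ext. intros x. split; intros [a Ha]; exists a; tauto. Qed.

Lemma Dset_cpfilter A : is_cpfilter Q A -> is_cpfilter Q (Dset A).
Proof.
  intros HA. unfold Dset. rewrite image_as_restricted.
  apply (image_cpfilter _ _ _ (fun a w => mul a w) HA); auto.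
  - destruct (filter_nonempty A HA) as [a Ha]; eauto.
  - apply star_mono.
  - intros a _ _. split; [apply mul_l_joins | split; [apply Hres1 |]].
    intros w Hw. rewrite star_restrict; auto.
Qed.

Lemma Rset_cpfilter A : is_cpfilter Q A -> is_cpfilter Q (Rset A).
Proof.
  intros HA. unfold Rset. rewrite image_as_restricted.
  apply (image_cpfilter _ _ _ (fun a w => mul w a) HA); auto.
  - destruct (filter_nonempty A HA) as [a Ha]; eauto.
  - apply plus_mono.
  - intros a _ _. split; [apply mul_r_joins | split; [apply Hres1 |]].
    intros w Hw. rewrite plus_restrict; auto.
Qed.

(* Hence cpf_d and cpf_r never take their junk value. *)
Lemma cpf_d_eq (A : cpf Q) : proj1_sig (cpf_d Q A) = Dset (proj1_sig A).
Proof.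
  unfold cpf_d, mkcpf. destruct excluded_middle_informative as [H|H]; [reflexivity|].
  exfalso. apply H, Dset_cpfilter, proj2_sig.
Qed.
Lemma cpf_r_eq (A : cpf Q) : proj1_sig (cpf_r Q A) = Rset (proj1_sig A).
Proof.
  unfold cpf_r, mkcpf. destruct excluded_middle_informative as [H|H]; [reflexivity|].
  exfalso. apply H, Rset_cpfilter, proj2_sig.
Qed.

Variable P : q_car Q -> Prop.
Hypothesis HP : frame_base Q P.
Let HPpi := base_pi Q P HP.
Let HPdown := base_down Q P HP.

Lemma base_le a b : P a -> le b a -> b = mul (pl b) a /\ b = mul a (st b).
Proof. intros Ha H. apply (HPpi a Ha b H). Qed.

Definition base_below (a x : q_car Q) : Prop := exists s, P s /\ is_meet Q a s x.

Lemma base_below_lub a : is_lub Q (base_below a) a.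
Proof.
  destruct top_exists as [t Ht].
  apply (Hdistr a P t a (base_top Q P HP t Ht) (meet_of_le a t (Ht a))).
Qed.

Lemma base_below_spec a x : base_below a x -> P x /\ le x a.
Proof.
  intros [s [Hs Hm]]. split; [eapply HPdown; [exact Hs | apply Hm] | apply Hm].
Qed.

Lemma filter_base A a : is_cpfilter Q A -> A a -> exists a1, P a1 /\ le a1 a /\ A a1.
Proof.
  intros HA Ha.
  destruct (filter_prime A HA _ _ (base_below_lub a) Ha) as [a1 [Ha1 HAa1]].
  destruct (base_below_spec a a1 Ha1). eauto.
Qed.

Lemma mul_proj_absorb_r m p : le p e -> le (st m) p -> mul m p = m.
Proof.
  intros Hp Hm. rewrite <- (proj1 (Hres1 m)) at 1.
  rewrite Hassoc, (proj1 (proj_le _ _ (proj1 (Hdr_proj m)) Hp Hm)). apply Hres1.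
Qed.
Lemma mul_proj_absorb_l m p : le p e -> le (pl m) p -> mul p m = m.
Proof.
  intros Hp Hm. rewrite <- (proj2 (Hres1 m)) at 1.
  rewrite <- Hassoc, (proj2 (proj_le _ _ (proj2 (Hdr_proj m)) Hp Hm)). apply Hres1.
Qed.

Definition Mset (A B : q_car Q -> Prop) :=
  upclose Q (fun x => exists a b, A a /\ B b /\ x = mul a b).

Lemma matching_base A B : is_cpfilter Q A -> is_cpfilter Q B -> Dset A = Rset B ->
  forall a b, A a -> B b -> exists a' b', A a' /\ B b' /\ P a' /\ P b' /\
    le a' a /\ le b' b /\ st a' = pl b'.
Proof.
  intros HA HB HDR a b Ha Hb.
  destruct (filter_base A a HA Ha) as [a1 [Pa1 [Ha1a Ha1]]].
  destruct (filter_base B b HB Hb) as [b1 [Pb1 [Hb1b Hb1]]].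
  pose proof (Hdr_proj a1) as [Hsa1 _]. pose proof (Hdr_proj b1) as [_ Hpb1].
  set (p := mul (st a1) (pl b1)).
  assert (Hmeet : is_meet Q (st a1) (pl b1) p) by (apply proj_meet; auto).
  assert (Hpe : le p e) by (apply Hproj; auto).
  assert (HpD : Dset A p).
  { apply (proj1 (proj2 (proj2 (Dset_cpfilter A HA)))) with (st a1) (pl b1); auto.
    - exists (st a1); split; eauto.
    - rewrite HDR. exists (pl b1); split; eauto. }
  assert (HpR : Rset B p) by (rewrite <- HDR; auto).
  destruct HpD as [y [[c [Hc ->]] Hcp]]. destruct HpR as [y [[d [Hd ->]] Hdp]].
  exists (mul a1 p), (mul p b1). repeat split.
  - destruct (filter_lower A HA a1 c Ha1 Hc) as [m [Hm [Hm1 Hm2]]].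
    apply (filter_up A HA m); auto.
    rewrite <- (mul_proj_absorb_r m p); [apply mul_monoR | |]; eauto using star_mono.
  - destruct (filter_lower B HB b1 d Hb1 Hd) as [m [Hm [Hm1 Hm2]]].
    apply (filter_up B HB m); auto.
    rewrite <- (mul_proj_absorb_l m p); [apply mul_monoL | |]; eauto using plus_mono.
  - apply (HPdown a1); auto. apply mul_proj_le_r; auto.
  - apply (HPdown b1); auto. apply mul_proj_le_l; auto.
  - eapply Htrans; [apply mul_proj_le_r|]; eauto.
  - eapply Htrans; [apply mul_proj_le_l|]; eauto.
  - rewrite star_restrict, plus_restrict; auto; apply Hmeet.
Qed.

Lemma star_composable_mul a b : st a = pl b -> st (mul a b) = st b.
Proof. intros E. rewrite (proj1 (Hres2 a b)), E. f_equal. apply Hres1. Qed.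

Lemma Mset_cpfilter A B : is_cpfilter Q A -> is_cpfilter Q B -> Dset A = Rset B ->
  is_cpfilter Q (Mset A B).
Proof.
  intros HA HB HDR. split; [|split; [|split; [|split]]].
  - destruct (filter_nonempty A HA) as [a Ha], (filter_nonempty B HB) as [b Hb].
    exists (mul a b), (mul a b). split; eauto 6.
  - intros a b [y [Hy H1]] H2. exists y. split; eauto.
  - intros x y m [x0 [[a1 [b1 [Ha1 [Hb1 ->]]]] H1]] [y0 [[a2 [b2 [Ha2 [Hb2 ->]]]] H2]] Hm.
    destruct (filter_lower A HA a1 a2 Ha1 Ha2) as [c [Hc [Hc1 Hc2]]].
    destruct (filter_lower B HB b1 b2 Hb1 Hb2) as [d [Hd [Hd1 Hd2]]].
    exists (mul c d). split; [eauto 6|].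
    apply Hm; eapply Htrans; eauto using mul_mono.
  - intros z Hz [y [[a [b [Ha [Hb ->]]]] H1]].
    destruct (matching_base A B HA HB HDR a b Ha Hb)
      as [a' [b' [Ha' [Hb' [_ [_ [Ha'a [Hb'b E]]]]]]]].
    apply (filter_not_bottom B HB b' Hb'). intros u.
    rewrite <- (proj1 (Hres1 b')), <- (star_composable_mul a' b' E).
    eapply Htrans; [apply mul_monoL, star_mono; eapply Htrans; [apply mul_mono|]; eauto|].
    apply (joins_bottom _ _ (mul_l_joins b')), (joins_bottom _ _ star_joins Hz).
  - intros S j Hj [y [[a [b [Ha [Hb ->]]]] H1]].
    destruct (matching_base A B HA HB HDR a b Ha Hb)
      as [a' [b' [Ha' [Hb' [Pa' [Pb' [Ha'a [Hb'b E]]]]]]]].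
    set (c := mul a' b').
    assert (Pc : P c) by (apply (base_mul Q P HP); auto).
    assert (Hcj : le c j) by (eapply Htrans; [apply mul_mono|]; eauto).
    pose proof (mul_l_joins b' _ _ (star_joins _ _ (Hdistr c S j c Hj (meet_of_le _ _ Hcj))))
      as HL.
    unfold c in HL. rewrite (star_composable_mul a' b' E), (proj1 (Hres1 b')) in HL.
    destruct (filter_prime B HB _ _ HL Hb') as [w [[y [[x [[s [Hs Hsx]] ->]] ->]] Hw]].
    exists s. split; auto. exists (mul a' (mul b' (st x))). split; [eauto 6|].
    rewrite <- Hassoc. fold c.
    rewrite <- (proj2 (base_le c x Pc (meet_le_l _ _ _ Hsx))). apply Hsx.
Qed.

Lemma filter_base_product Z a b : is_cpfilter Q Z -> Z (mul a b) ->
  exists a1 b1, P a1 /\ P b1 /\ le a1 a /\ le b1 b /\ Z (mul a1 b1).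
Proof.
  intros HZ Hab.
  destruct (filter_prime Z HZ _ _ (mul_r_joins b _ _ (base_below_lub a)) Hab)
    as [w [[x [Hx ->]] Hxb]].
  destruct (filter_prime Z HZ _ _ (mul_l_joins x _ _ (base_below_lub b)) Hxb)
    as [w [[y [Hy ->]] Hxy]].
  apply base_below_spec in Hx; apply base_below_spec in Hy.
  exists x, y. intuition.
Qed.

(* Factorization below a composable product c = a1 b2 of base elements:
   every z <= c is the composable product of its left factor (pl z) a1 and its
   right factor b2 (st z). *)
Section Factorization.
Variables a1 b2 : q_car Q.
Hypothesis Pa1 : P a1.
Hypothesis Pb2 : P b2.
Hypothesis Hcomp : le (pl b2) (st a1).

Definition left_factor z := mul (pl z) a1.
Definition right_factor z := mul b2 (st z).
Let c := mul a1 b2.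

Lemma left_factor_mono z z' : le z z' -> le (left_factor z) (left_factor z').
Proof. intros; apply mul_monoR, plus_mono; auto. Qed.
Lemma right_factor_mono z z' : le z z' -> le (right_factor z) (right_factor z').
Proof. intros; apply mul_monoL, star_mono; auto. Qed.

Lemma below_product z : le z c -> z = mul a1 (right_factor z).
Proof.
  intros Hz. unfold right_factor. rewrite <- Hassoc.
  apply (base_le c z (base_mul Q P HP _ _ Pa1 Pb2) Hz).
Qed.

Lemma factors_mul z : le z c -> mul (left_factor z) (right_factor z) = z.
Proof.
  intros Hz. unfold left_factor. rewrite Hassoc, <- below_product; auto. apply Hres1.
Qed.

Lemma factors_match z : le z c -> st (left_factor z) = pl (right_factor z).
Proof.
  intros Hz.
  assert (Hy : le (pl (right_factor z)) (st a1)).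
  { eapply Htrans; [apply plus_mono, mul_proj_le_r, Hdr_proj | exact Hcomp]. }
  assert (Ex : left_factor z = mul a1 (pl (right_factor z))).
  { unfold left_factor at 1. rewrite (below_product z Hz) at 1.
    rewrite (proj2 (Hres2 a1 (right_factor z))).
    symmetry. apply (base_le a1); auto. apply mul_proj_le_r, Hdr_proj. }
  rewrite Ex. apply star_restrict; auto.
Qed.

Definition left_filter Z := upclose Q (fun x => exists z, Z z /\ le z c /\ x = left_factor z).
Definition right_filter Z := upclose Q (fun x => exists z, Z z /\ le z c /\ x = right_factor z).

Lemma left_filter_cpfilter Z : is_cpfilter Q Z -> Z c -> is_cpfilter Q (left_filter Z).
Proof.
  intros HZ HZc.
  apply (image_cpfilter _ _ _ (fun z w => mul w (right_factor z)) HZ); eauto.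
  - apply left_factor_mono.
  - intros z _ Hzc. split; [apply mul_r_joins | split; [apply factors_mul; auto |]].
    intros w Hw.
    assert (Hwz : le (mul w (right_factor z)) z).
    { rewrite <- (factors_mul z Hzc) at 2. apply mul_monoR; auto. }
    split; [eauto|].
    assert (Hwa : le w a1) by (eapply Htrans; [exact Hw | apply mul_proj_le_l, Hdr_proj]).
    rewrite (proj1 (base_le a1 w Pa1 Hwa)) at 2.
    apply mul_monoR, plus_mul_le.
Qed.

Lemma right_filter_cpfilter Z : is_cpfilter Q Z -> Z c -> is_cpfilter Q (right_filter Z).
Proof.
  intros HZ HZc.
  apply (image_cpfilter _ _ _ (fun z w => mul (left_factor z) w) HZ); eauto.
  - apply right_factor_mono.
  - intros z _ Hzc. split; [apply mul_l_joins | split; [apply factors_mul; auto |]].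
    intros w Hw.
    assert (Hwz : le (mul (left_factor z) w) z).
    { rewrite <- (factors_mul z Hzc) at 2. apply mul_monoL; auto. }
    split; [eauto|].
    assert (Hwb : le w b2) by (eapply Htrans; [exact Hw | apply mul_proj_le_r, Hdr_proj]).
    rewrite (proj2 (base_le b2 w Pb2 Hwb)) at 2.
    apply mul_monoL, star_mul_le.
Qed.

Lemma factor_filters_compose Z : Dset (left_filter Z) = Rset (right_filter Z).
Proof.
  apply pred_ext. intros q. split.
  - intros [y [[u [[x0 [[z [Hz [Hzc ->]]] Hu]] ->]] Hq]].
    exists (pl (right_factor z)). split.
    + exists (right_factor z). split; auto. exists (right_factor z). split; eauto.
    + rewrite <- factors_match; auto. eapply Htrans; [apply star_mono|]; eauto.
  - intros [y [[u [[x0 [[z [Hz [Hzc ->]]] Hu]] ->]] Hq]].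
    exists (st (left_factor z)). split.
    + exists (left_factor z). split; auto. exists (left_factor z). split; eauto.
    + rewrite factors_match; auto. eapply Htrans; [apply plus_mono|]; eauto.
Qed.

Lemma factor_filters_product Z : is_cpfilter Q Z -> Z c ->
  Z = Mset (left_filter Z) (right_filter Z).
Proof.
  intros HZ HZc. apply pred_ext. intros q. split.
  - intros Hq. destruct (filter_lower Z HZ q c Hq HZc) as [z [Hz [Hzq Hzc]]].
    exists z. split; auto. exists (left_factor z), (right_factor z). split; [|split].
    + exists (left_factor z). split; eauto.
    + exists (right_factor z). split; eauto.
    + symmetry; apply factors_mul; auto.
  - intros [y [[u [v [[x0 [[z1 [Hz1 [Hz1c ->]]] Hu]]
                       [[y0 [[z2 [Hz2 [Hz2c ->]]] Hv]] ->]]]] Hq]].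
    destruct (filter_lower Z HZ z1 z2 Hz1 Hz2) as [z [Hz [Hzz1 Hzz2]]].
    apply (filter_up Z HZ z); auto.
    rewrite <- (factors_mul z); [|eauto].
    eapply Htrans; [apply mul_mono | exact Hq].
    + eapply Htrans; [apply (left_factor_mono z z1)|]; auto.
    + eapply Htrans; [apply (right_factor_mono z z2)|]; auto.
Qed.

End Factorization.

Lemma filter_decomposition Z a b : is_cpfilter Q Z -> Z (mul a b) ->
  exists A B, is_cpfilter Q A /\ is_cpfilter Q B /\ A a /\ B b /\
    Dset A = Rset B /\ Z = Mset A B.
Proof.
  intros HZ Hab.
  destruct (filter_base_product Z a b HZ Hab) as [a1 [b1 [Pa1 [Pb1 [Ha1 [Hb1 HZ1]]]]]].
  set (b2 := mul (st a1) b1).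
  assert (Hb2b1 : le b2 b1) by (apply mul_proj_le_l, Hdr_proj).
  assert (Pb2 : P b2) by (apply (HPdown b1); auto).
  assert (Hcomp : le (pl b2) (st a1)).
  { eapply Htrans; [apply plus_mul_le | rewrite (proj2 (Hfix _ (proj1 (Hdr_proj a1))))].
    apply Hrefl. }
  assert (HZc : Z (mul a1 b2)).
  { unfold b2. rewrite <- Hassoc, (proj1 (Hres1 a1)). auto. }
  exists (left_filter a1 b2 Z), (right_filter a1 b2 Z).
  refine (conj _ (conj _ (conj _ (conj _ (conj _ _))))).
  - apply left_filter_cpfilter; auto.
  - apply right_filter_cpfilter; auto.
  - exists (left_factor a1 (mul a1 b2)). split; [exists (mul a1 b2); eauto |].
    eapply Htrans; [apply mul_proj_le_l, Hdr_proj | auto].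
  - exists (right_factor b2 (mul a1 b2)). split; [exists (mul a1 b2); eauto |].
    eapply Htrans; [apply mul_proj_le_r, Hdr_proj | eauto].
  - apply factor_filters_compose; auto.
  - apply factor_filters_product; auto.
Qed.

Lemma X_up a b (A : cpf Q) : le a b -> Xset Q a A -> Xset Q b A.
Proof. intros H Ha. apply (filter_up _ (proj2_sig A) a); auto. Qed.

Lemma X_meet a b m (A : cpf Q) : is_meet Q a b m -> (Xset Q m A <-> Xset Q a A /\ Xset Q b A).
Proof.
  intros Hm. unfold Xset. destruct A as [A HA]; simpl. split.
  - intros H. split; apply (filter_up A HA m); auto; apply Hm.
  - intros [Ha Hb]. apply (proj1 (proj2 (proj2 HA)) a b m); auto.
Qed.

Lemma X_lub S j (A : cpf Q) : is_lub Q S j -> (Xset Q j A <-> exists s, S s /\ Xset Q s A).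
Proof.
  intros Hj. unfold Xset. destruct A as [A HA]; simpl. split.
  - apply (filter_prime A HA S j Hj).
  - intros [s [Hs H]]. apply (filter_up A HA s); auto. apply Hj; auto.
Qed.

Lemma X_top t (A : cpf Q) : (forall x, le x t) -> Xset Q t A.
Proof.
  intros Ht. destruct (filter_nonempty _ (proj2_sig A)) as [a Ha]. apply (X_up a); auto.
Qed.

(* Every X_a is open (a union of basic opens X_s with s in the base) ... *)
Lemma X_open a : tc_open (Ccat Q) (Xset Q a).
Proof.
  assert (E : Xset Q a = fun A => exists U,
      (fun U => exists x, base_below a x /\ U = Xset Q x) U /\ U A).
  { apply pred_ext. intros A. rewrite (X_lub _ _ A (base_below_lub a)). split.
    - intros [s [Hs H]]. exists (Xset Q s). eauto.
    - intros [U [[x [Hx ->]] H]]. eauto. }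
  rewrite E. apply (proj1 (gen_topology_is_topology _)).
  intros U [x [Hx ->]]. apply gen_basic. exists x.
  split; auto. apply HPpi, (base_below_spec a x Hx).
Qed.

(* ... and every open set is some X_a, since the X_a form a topology. *)
Lemma open_is_X S : tc_open (Ccat Q) S -> exists a, S = Xset Q a.
Proof.
  simpl. intros H. apply H.
  - split; [|split].
    + intros F HF. destruct (Hlub (fun a => F (Xset Q a))) as [j Hj]. exists j.
      apply pred_ext. intros A. rewrite (X_lub _ _ A Hj). split.
      * intros [U [HU HA]]. destruct (HF U HU) as [a ->]. eauto.
      * intros [s [Hs HA]]. eauto.
    + intros U V [a ->] [b ->]. destruct (meet_exists a b) as [m Hm]. exists m.
      apply pred_ext. intros A. rewrite (X_meet a b m A Hm). tauto.
    + destruct top_exists as [t Ht]. exists t. apply pred_ext. intros A.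
      split; auto. intros _. apply X_top; auto.
  - intros U [a [_ ->]]. eauto.
Qed.

Lemma X_mul a b (Z : cpf Q) :
  (exists A B : cpf Q, Xset Q a A /\ Xset Q b B /\ cpf_d Q A = cpf_r Q B /\ cpf_mul Q A B Z)
  <-> Xset Q (mul a b) Z.
Proof.
  split.
  - intros [A [B [Ha [Hb [_ [_ HZ]]]]]]. unfold Xset. rewrite HZ.
    exists (mul a b). split; [exists a, b; auto | apply Hrefl].
  - intros HZ. destruct (filter_decomposition _ a b (proj2_sig Z) HZ)
      as [A [B [HA [HB [Ha [Hb [HDR EZ]]]]]]].
    assert (E : cpf_d Q (exist _ A HA) = cpf_r Q (exist _ B HB)).
    { apply cpf_eq. rewrite cpf_d_eq, cpf_r_eq. exact HDR. }
    exists (exist _ A HA), (exist _ B HB). repeat split; auto.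
Qed.

Definition left_translate (a1 : q_car Q) (Y : q_car Q -> Prop) :=
  upclose Q (fun u => exists p, Y p /\ le p (st a1) /\ u = mul a1 p).
Definition right_translate (Y : q_car Q -> Prop) (a1 : q_car Q) :=
  upclose Q (fun u => exists p, Y p /\ le p (pl a1) /\ u = mul p a1).

Lemma left_translate_cpfilter a1 Y : P a1 -> is_cpfilter Q Y -> Y (st a1) ->
  is_cpfilter Q (left_translate a1 Y).
Proof.
  intros Pa1 HY Ya1.
  apply (image_cpfilter _ _ _ (fun _ w => st w) HY); eauto using mul_monoL.
  intros p _ Hp. split; [apply star_joins | split; [apply star_restrict; auto |]].
  intros w Hw. split.
  - eapply Htrans; [apply star_mono, Hw | rewrite star_restrict; auto].
  - assert (Hwa : le w a1).
    { eapply Htrans; [exact Hw | apply mul_proj_le_r; eapply Htrans; eauto; apply Hdr_proj]. }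
    rewrite <- (proj2 (base_le a1 w Pa1 Hwa)). apply Hrefl.
Qed.

Lemma right_translate_cpfilter a1 Y : P a1 -> is_cpfilter Q Y -> Y (pl a1) ->
  is_cpfilter Q (right_translate Y a1).
Proof.
  intros Pa1 HY Ya1.
  apply (image_cpfilter _ _ _ (fun _ w => pl w) HY); eauto using mul_monoR.
  intros p _ Hp. split; [apply plus_joins | split; [apply plus_restrict; auto |]].
  intros w Hw. split.
  - eapply Htrans; [apply plus_mono, Hw | rewrite plus_restrict; auto].
  - assert (Hwa : le w a1).
    { eapply Htrans; [exact Hw | apply mul_proj_le_l; eapply Htrans; eauto; apply Hdr_proj]. }
    rewrite <- (proj1 (base_le a1 w Pa1 Hwa)). apply Hrefl.
Qed.

Lemma left_translate_dom a1 Y : is_cpfilter Q Y -> Y (st a1) -> Dset (left_translate a1 Y) = Y.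
Proof.
  intros HY Ya1. apply pred_ext. intros q. split.
  - intros [w [[u [[u0 [[p [Hp [Hpa ->]]] Hu]] ->]] Hq]].
    apply (filter_up Y HY p); auto. eapply Htrans; [|exact Hq].
    rewrite <- (star_restrict a1 p Hpa) at 1. apply star_mono; auto.
  - intros Hq. destruct (filter_lower Y HY q (st a1) Hq Ya1) as [p [Hp [Hpq Hpa]]].
    exists p. split; auto. exists (mul a1 p). split; [|rewrite star_restrict; auto].
    exists (mul a1 p). split; eauto.
Qed.

Lemma right_translate_ran a1 Y : is_cpfilter Q Y -> Y (pl a1) -> Rset (right_translate Y a1) = Y.
Proof.
  intros HY Ya1. apply pred_ext. intros q. split.
  - intros [w [[u [[u0 [[p [Hp [Hpa ->]]] Hu]] ->]] Hq]].
    apply (filter_up Y HY p); auto. eapply Htrans; [|exact Hq].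
    rewrite <- (plus_restrict a1 p Hpa) at 1. apply plus_mono; auto.
  - intros Hq. destruct (filter_lower Y HY q (pl a1) Hq Ya1) as [p [Hp [Hpq Hpa]]].
    exists p. split; auto. exists (mul p a1). split; [|rewrite plus_restrict; auto].
    exists (mul p a1). split; eauto.
Qed.

Lemma X_star a (y : cpf Q) : (exists x, Xset Q a x /\ y = cpf_d Q x) <-> Xset Q (st a) y.
Proof.
  split.
  - intros [x [Hx ->]]. unfold Xset. rewrite cpf_d_eq. exists (st a). split; eauto.
  - destruct y as [Y HY]. unfold Xset; simpl. intros Hy.
    destruct (filter_prime Y HY _ _ (star_joins _ _ (base_below_lub a)) Hy)
      as [w [[a1 [Ha1 ->]] Ya1]].
    destruct (base_below_spec a a1 Ha1) as [Pa1 Ha1a].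
    exists (exist _ _ (left_translate_cpfilter a1 Y Pa1 HY Ya1)). split.
    + apply (X_up a1); auto. exists a1. split; [|apply Hrefl].
      exists (st a1). rewrite (proj1 (Hres1 a1)). auto.
    + apply cpf_eq. rewrite cpf_d_eq. symmetry. apply left_translate_dom; auto.
Qed.

Lemma X_plus a (y : cpf Q) : (exists x, Xset Q a x /\ y = cpf_r Q x) <-> Xset Q (pl a) y.
Proof.
  split.
  - intros [x [Hx ->]]. unfold Xset. rewrite cpf_r_eq. exists (pl a). split; eauto.
  - destruct y as [Y HY]. unfold Xset; simpl. intros Hy.
    destruct (filter_prime Y HY _ _ (plus_joins _ _ (base_below_lub a)) Hy)
      as [w [[a1 [Ha1 ->]] Ya1]].
    destruct (base_below_spec a a1 Ha1) as [Pa1 Ha1a].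
    exists (exist _ _ (right_translate_cpfilter a1 Y Pa1 HY Ya1)). split.
    + apply (X_up a1); auto. exists a1. split; [|apply Hrefl].
      exists (pl a1). rewrite (proj2 (Hres1 a1)). auto.
    + apply cpf_eq. rewrite cpf_r_eq. symmetry. apply right_translate_ran; auto.
Qed.

Lemma X_e (A : cpf Q) : cpf_d Q A = A <-> Xset Q e A.
Proof.
  destruct A as [A HA]. unfold Xset; simpl. split.
  - intros H. apply (f_equal (@proj1_sig _ _)) in H. rewrite cpf_d_eq in H. simpl in H.
    rewrite <- H. destruct (filter_nonempty A HA) as [a Ha].
    exists (st a). split; [eauto | apply Hdr_proj].
  - intros He. apply cpf_eq. rewrite cpf_d_eq. simpl. apply pred_ext. intros q. split.
    + intros [w [[a [Ha ->]] Hq]].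
      destruct (filter_lower A HA a e Ha He) as [m [Hm [Hma Hme]]].
      apply (filter_up A HA m); auto. eapply Htrans; [|exact Hq].
      rewrite <- (proj1 (Hfix m Hme)). apply star_mono; auto.
    + intros Hq. destruct (filter_lower A HA q e Hq He) as [m [Hm [Hmq Hme]]].
      exists m. split; auto. exists m. split; auto. symmetry. apply (Hfix m Hme).
Qed.

Local Notation OQ := (Omega (Ccat Q)).

Definition chi (a : q_car Q) : opens (Ccat Q) := exist _ (Xset Q a) (X_open a).

Lemma chi_onto (U : opens (Ccat Q)) : exists a, U = chi a.
Proof.
  destruct (open_is_X _ (proj2_sig U)) as [a Ha].
  exists a. apply opens_eq. intros x. rewrite Ha. reflexivity.
Qed.

Lemma mkopen_X S a : S = Xset Q a -> mkopen (Ccat Q) S = chi a.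
Proof. intros ->. apply opens_eq. intros x. rewrite mkopen_eq; [reflexivity | apply X_open]. Qed.

Lemma chi_le a b : le a b -> q_le OQ (chi a) (chi b).
Proof. intros H A. apply X_up; auto. Qed.

Lemma chi_mul a b : q_mul OQ (chi a) (chi b) = chi (mul a b).
Proof. apply mkopen_X, pred_ext. intros z. apply X_mul. Qed.
Lemma chi_star a : q_star OQ (chi a) = chi (st a).
Proof. apply mkopen_X, pred_ext. intros z. apply X_star. Qed.
Lemma chi_plus a : q_plus OQ (chi a) = chi (pl a).
Proof. apply mkopen_X, pred_ext. intros z. apply X_plus. Qed.
Lemma chi_e : q_e OQ = chi e.
Proof. apply mkopen_X, pred_ext. intros z. apply X_e. Qed.

Lemma spatial_of_enough_points :
  (forall a b, (forall A : cpf Q, Xset Q a A -> Xset Q b A) -> le a b) -> spatial Q.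
Proof.
  intros Hsep. exists chi. split; [reflexivity|].
  repeat split.
  - intros a b H. apply (f_equal (@proj1_sig _ _)) in H. simpl in H.
    apply Hanti; apply Hsep; intros A; rewrite H; auto.
  - intros y. destruct (chi_onto y) as [a ->]. eauto.
  - apply chi_le.
  - intros Hab. apply Hsep. intros A HA. apply (Hab A HA).
  - intros a b. symmetry. apply chi_mul.
  - symmetry. apply chi_e.
  - intros a. symmetry. apply chi_star.
  - intros a. symmetry. apply chi_plus.
Qed.

Definition omega_pt (x : cpf Q) : cpf OQ :=
  exist _ (nbhd_filter (C := Ccat Q) x) (nbhd_cpfilter (C := Ccat Q) x).

Lemma omega_injective x y : omega_pt x = omega_pt y -> x = y.
Proof.
  intros H. apply (f_equal (@proj1_sig _ _)) in H. simpl in H.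
  apply cpf_eq, pred_ext. intros a.
  pose proof (f_equal (fun F => F (chi a)) H) as Ea.
  exact (eq_ind _ (fun X => _ <-> X) (iff_refl _) _ Ea).
Qed.

(* A completely prime filter Y of opens of C(Q) is the neighbourhood filter
   of the point {a | X_a in Y}. *)
Lemma omega_onto (y : cpf OQ) : exists x, omega_pt x = y.
Proof.
  destruct y as [Y HY].
  set (A := fun a => Y (chi a)).
  assert (HA : is_cpfilter Q A).
  { split; [|split; [|split; [|split]]].
    - destruct (filter_nonempty Y HY) as [U HU]. destruct (chi_onto U) as [a ->].
      exists a. auto.
    - intros a b Ha Hab. apply (filter_up Y HY (chi a)); auto. apply chi_le; auto.
    - intros a b m Ha Hb Hm. apply (proj1 (proj2 (proj2 HY)) (chi a) (chi b)); auto.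
      apply Omega_meet. intros x. apply X_meet; auto.
    - intros z Hz Hza. apply (filter_not_bottom Y HY (chi z) Hza).
      intros u x Hx. exfalso. apply (filter_not_bottom _ (proj2_sig x) z Hx Hz).
    - intros S j Hj Hja.
      assert (HL : is_lub OQ (fun U => exists s, S s /\ U = chi s) (chi j)).
      { apply Omega_lub. intros x. simpl. rewrite (X_lub S j x Hj). split.
        - intros [s [Hs Hx]]. exists (chi s). eauto.
        - intros [V [[s [Hs ->]] Hx]]. eauto. }
      destruct (filter_prime Y HY _ _ HL Hja) as [U [[s [Hs ->]] HU]]. eauto. }
  exists (exist _ A HA). apply cpf_eq, pred_ext. intros U.
  destruct (chi_onto U) as [a ->]. reflexivity.
Qed.

Lemma omega_d x : omega_pt (cpf_d Q x) = cpf_d OQ (omega_pt x).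
Proof.
  symmetry. apply mkcpf_eq, pred_ext. intros V. destruct (chi_onto V) as [c ->]. split.
  - intros [W [[U [HU ->]] HW]]. destruct (chi_onto U) as [a ->].
    rewrite chi_star in HW. apply HW, X_star. exists x. split; [exact HU | reflexivity].
  - simpl. unfold nbhd_filter, Xset. rewrite cpf_d_eq. intros [w [[a [Ha ->]] Hc]].
    exists (q_star OQ (chi a)). split; [exists (chi a); auto|].
    rewrite chi_star. apply chi_le; auto.
Qed.

Lemma omega_r x : omega_pt (cpf_r Q x) = cpf_r OQ (omega_pt x).
Proof.
  symmetry. apply mkcpf_eq, pred_ext. intros V. destruct (chi_onto V) as [c ->]. split.
  - intros [W [[U [HU ->]] HW]]. destruct (chi_onto U) as [a ->].
    rewrite chi_plus in HW. apply HW, X_plus. exists x. split; [exact HU | reflexivity].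
  - simpl. unfold nbhd_filter, Xset. rewrite cpf_r_eq. intros [w [[a [Ha ->]] Hc]].
    exists (q_plus OQ (chi a)). split; [exists (chi a); auto|].
    rewrite chi_plus. apply chi_le; auto.
Qed.

Lemma omega_product x y : cpf_d Q x = cpf_r Q y -> forall c,
  upclose OQ (fun W => exists U V,
      proj1_sig (omega_pt x) U /\ proj1_sig (omega_pt y) V /\ W = q_mul OQ U V) (chi c)
  <-> Mset (proj1_sig x) (proj1_sig y) c.
Proof.
  intros Hdr c.
  assert (HDR : Dset (proj1_sig x) = Rset (proj1_sig y)).
  { rewrite <- cpf_d_eq, <- cpf_r_eq, Hdr. reflexivity. }
  set (W := exist _ _ (Mset_cpfilter _ _ (proj2_sig x) (proj2_sig y) HDR) : cpf Q).
  split.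
  - intros [W' [[U [V [HU [HV ->]]]] HW]].
    destruct (chi_onto U) as [a ->], (chi_onto V) as [b ->].
    rewrite chi_mul in HW. apply (HW W).
    exists (mul a b). split; [exists a, b; auto | apply Hrefl].
  - intros [w [[a [b [Ha [Hb ->]]]] Hw]]. exists (chi (mul a b)). split.
    + exists (chi a), (chi b). repeat split; auto. symmetry; apply chi_mul.
    + apply chi_le; auto.
Qed.

Lemma omega_mul x y z : cpf_mul Q x y z <-> cpf_mul OQ (omega_pt x) (omega_pt y) (omega_pt z).
Proof.
  unfold cpf_mul. rewrite <- omega_d, <- omega_r. split.
  - intros [Hdr HZ]. split; [rewrite Hdr; reflexivity|].
    apply pred_ext. intros V. destruct (chi_onto V) as [c ->].
    rewrite (omega_product x y Hdr c). simpl. unfold nbhd_filter, Xset. rewrite HZ. reflexivity.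
  - intros [Hdr HZ]. apply omega_injective in Hdr. split; auto.
    apply pred_ext. intros c. rewrite <- (omega_product x y Hdr c), <- HZ. reflexivity.
Qed.

(* omega is continuous: the preimage of every generating open is an X_a. *)
Lemma omega_continuous V : tc_open (Ccat OQ) V -> tc_open (Ccat Q) (fun x => V (omega_pt x)).
Proof.
  intros HV. apply (HV (fun V => tc_open (Ccat Q) (fun x => V (omega_pt x)))).
  - split; [|split].
    + intros F HF.
      apply (open_ext (C := Ccat Q) (fun x => exists W,
        (fun W => exists U, F U /\ W = fun x => U (omega_pt x)) W /\ W x)).
      * intros x. split.
        -- intros [W [[U [HU ->]] Hx]]. eauto.
        -- intros [U [HU Hx]]. exists (fun x => U (omega_pt x)). eauto.
      * apply (open_union (C := Ccat Q)). intros W [U [HU ->]]. auto.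
    + intros U V' HU HV'. exact (open_inter (C := Ccat Q) _ _ HU HV').
    + exact (open_full (C := Ccat Q)).
  - intros U [a [Ha ->]]. exact (proj2_sig a).
Qed.

Lemma chi_base_pi s : P s -> partial_isometry OQ (chi s).
Proof.
  intros Ps b Hb. destruct (chi_onto b) as [c ->].
  destruct (meet_exists c s) as [m Hm].
  assert (E : chi c = chi m).
  { apply opens_eq. intros A. simpl. rewrite (X_meet c s m A Hm). split; [|tauto].
    intros H. split; auto. apply Hb. exact H. }
  rewrite E, chi_plus, chi_star, !chi_mul.
  split; f_equal; apply (HPpi s Ps m), Hm.
Qed.

(* omega is open: the image of X_a is the union of the basic opens X_{chi s}
   of Omega(C(Q)), for base elements s below a. *)
Lemma omega_open U : tc_open (Ccat Q) U ->
  tc_open (Ccat OQ) (fun y => exists x, U x /\ y = omega_pt x).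
Proof.
  intros HU. destruct (open_is_X U HU) as [a ->].
  apply (open_ext (C := Ccat OQ) (fun y => exists W,
      (fun W => exists s, base_below a s /\ W = Xset OQ (chi s)) W /\ W y)).
  - intros y. split.
    + intros [W [[s [Hs ->]] Hy]]. destruct (omega_onto y) as [x <-]. exists x. split; auto.
      apply (X_up s a); [apply (base_below_spec a s Hs) | exact Hy].
    + intros [x [Hx ->]]. apply (X_lub _ _ x (base_below_lub a)) in Hx.
      destruct Hx as [s [Hs Hx]].
      exists (Xset OQ (chi s)). split; [eauto | exact Hx].
  - apply (open_union (C := Ccat OQ)). intros W [s [Hs ->]]. apply gen_basic.
    exists (chi s). split; auto. apply chi_base_pi, (base_below_spec a s Hs).
Qed.

Lemma Ccat_sober : sober (Ccat Q).
Proof.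
  exists omega_pt. split; [reflexivity|].
  split.
  - exact (conj omega_injective (conj omega_onto (conj omega_d (conj omega_r omega_mul)))).
  - exact (conj omega_injective (conj omega_onto (conj omega_continuous omega_open))).
Qed.

End RestrictionFrame.

Lemma RQF_restriction_frame Q : is_RQF Q -> restriction_frame Q.
Proof.
  intros [H1 [H2 [H3 [H4 [H5 [H6 [H7 [H8 [H9 [H10 [H11 [H12 [H13 [H14 _]]]]]]]]]]]]]].
  constructor; assumption.
Qed.

Lemma RQF_partial_isometry_base Q : is_RQF Q -> frame_base Q (partial_isometry Q).
Proof.
  intros HQ. constructor.
  - auto.
  - apply partial_isometry_down, RQF_restriction_frame, HQ.
  - apply HQ.
  - apply HQ.
Qed.

Section Etale.
Variable C : TopCat.
Hypothesis HC : is_etale C.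
Local Notation d := (tc_d C).
Local Notation r := (tc_r C).
Local Notation m := (tc_mul C).
Local Notation op := (tc_open C).
Local Notation O := (Omega C).

Lemma units_idem x : d (d x) = d x /\ r (d x) = d x /\ d (r x) = r x /\ r (r x) = r x.
Proof. apply HC. Qed.
Lemma mul_composable x y z : m x y z -> d x = r y.
Proof. apply HC. Qed.
Lemma mul_exists x y : d x = r y -> exists z, m x y z.
Proof. apply HC. Qed.
Lemma mul_unique x y z z' : m x y z -> m x y z' -> z = z'.
Proof. apply HC. Qed.
Lemma mul_d_r x y z : m x y z -> d z = d y /\ r z = r x.
Proof. apply HC. Qed.
Lemma mul_units x : m x (d x) x /\ m (r x) x x.
Proof. apply HC. Qed.
Lemma mul_assoc_lr x y w u v : m x y u -> m u w v -> exists t, m y w t /\ m x t v.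
Proof. apply HC. Qed.
Lemma mul_assoc_rl x y w t v : m y w t -> m x t v -> exists u, m x y u /\ m u w v.
Proof. apply HC. Qed.

Lemma mul_unit_l u z : m (r u) u z -> z = u.
Proof. intros H. apply (mul_unique _ _ _ _ H (proj2 (mul_units u))). Qed.
Lemma mul_unit_r u z : m u (d u) z -> z = u.
Proof. intros H. apply (mul_unique _ _ _ _ H (proj1 (mul_units u))). Qed.

Lemma unit_of_d x : d x = x -> r x = x.
Proof. intros H. rewrite <- H. apply units_idem. Qed.

Definition image (f : tc_car C -> tc_car C) (U : tc_car C -> Prop) : tc_car C -> Prop :=
  fun y => exists x, U x /\ y = f x.
Definition set_mul (U V : tc_car C -> Prop) : tc_car C -> Prop :=
  fun z => exists u v, U u /\ V v /\ d u = r v /\ m u v z.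
Definition units : tc_car C -> Prop := fun x => d x = x.

Lemma image_open f U : tc_local_homeo C f -> op U -> op (image f U).
Proof.
  intros [_ Hf] HU.
  apply (open_ext (fun y => exists W, (fun W => exists x N, op N /\ N x /\
      (forall V, op V -> (forall y, V y -> N y) -> op (image f V)) /\
      W = image f (fun y => U y /\ N y)) W /\ W y)).
  - intros y. split.
    + intros [W [[x [N [HN [Nx [Hi ->]]]]] [x' [[Ux' _] ->]]]]. exists x'. auto.
    + intros [x' [Ux' ->]]. destruct (Hf x') as [N [HN [Nx [_ Hi]]]].
      exists (image f (fun y => U y /\ N y)). split; [exists x', N; auto | exists x'; auto].
  - apply open_union. intros W [x [N [HN [Nx [Hi ->]]]]]. apply Hi.
    + apply open_inter; auto.
    + intros y [_ Hy]; auto.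
Qed.

Lemma open_of_local S : (forall z, S z -> exists N, op N /\ N z /\ forall w, N w -> S w) -> op S.
Proof.
  intros H. apply (open_ext (fun z => exists N, (fun N => op N /\ forall w, N w -> S w) N /\ N z)).
  - intros z. split.
    + intros [N [[_ HN] Hz]]. auto.
    + intros Hz. destruct (H z Hz) as [N [HN [Nz HNS]]]. exists N. auto.
  - apply open_union. intros N [HN _]; auto.
Qed.

(* The product of open sets is open: near a product z = u v, every w on which
   d is injective, whose domain is the domain of some v' near v with r v'
   the domain of some u' near u, is the product u' v'. *)
Lemma set_mul_open U V : op U -> op V -> op (set_mul U V).
Proof.
  destruct HC as [_ [Hdc [Hrc [Hmc [Hdl _]]]]].
  intros HU HV. apply open_of_local. intros z [u [v [Uu [Vv [Hdr Hm]]]]].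
  destruct (proj2 Hdl z) as [W [HW [Wz [Winj _]]]].
  destruct (Hmc W HW u v z Hm Wz) as [U1 [V1 [HU1 [HV1 [U1u [V1v H1]]]]]].
  set (U2 := fun y => U y /\ U1 y). set (V2 := fun y => V y /\ V1 y).
  set (V3 := fun y => V2 y /\ image d U2 (r y)).
  assert (HV3 : op V3).
  { apply open_inter; [apply open_inter; auto|]. apply (Hrc (image d U2)), image_open; auto.
    apply open_inter; auto. }
  exists (fun w => W w /\ image d V3 (d w)). split; [|split].
  - apply open_inter; auto. apply (Hdc (image d V3)), image_open; auto.
  - split; auto. exists v. split; [|apply (mul_d_r _ _ _ Hm)].
    split; [split; auto|]. exists u. split; [split; auto | auto].
  - intros w [Ww [v' [[[Vv' V1v'] [u' [[Uu' U1u'] Hru']]] Hdw]]].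
    destruct (mul_exists u' v' (eq_sym Hru')) as [w' Hw'].
    assert (E : w = w').
    { apply Winj; [auto | apply (H1 u' v'); auto |].
      rewrite Hdw. symmetry. apply (mul_d_r _ _ _ Hw'). }
    subst w'. exists u', v'. repeat split; auto.
Qed.

Lemma units_open : op units.
Proof.
  apply (open_ext (image d (fun _ => True))).
  - intros x. split.
    + intros [y [_ ->]]. apply units_idem.
    + intros Hx. exists x. split; auto.
  - apply image_open; [apply HC | apply open_full].
Qed.

Lemma Omega_mul_eq (U V : opens C) : proj1_sig (q_mul O U V) = set_mul (proj1_sig U) (proj1_sig V).
Proof. apply mkopen_eq, set_mul_open; apply proj2_sig. Qed.
Lemma Omega_star_eq (U : opens C) : proj1_sig (q_star O U) = image d (proj1_sig U).
Proof. apply mkopen_eq, image_open; [apply HC | apply proj2_sig]. Qed.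
Lemma Omega_plus_eq (U : opens C) : proj1_sig (q_plus O U) = image r (proj1_sig U).
Proof. apply mkopen_eq, image_open; [apply HC | apply proj2_sig]. Qed.
Lemma Omega_e_eq : proj1_sig (q_e O) = units.
Proof. apply mkopen_eq, units_open. Qed.

Lemma Omega_assoc a b c : q_mul O (q_mul O a b) c = q_mul O a (q_mul O b c).
Proof.
  apply opens_eq. intros z. rewrite !Omega_mul_eq. split.
  - intros [p [w [Hp [Hw [_ Hm]]]]].
    destruct Hp as [u [v [Hu [Hv [_ Hm']]]]].
    destruct (mul_assoc_lr _ _ _ _ _ Hm' Hm) as [t [Ht1 Ht2]].
    exists u, t. repeat split; auto; [|apply (mul_composable _ _ _ Ht2)].
    exists v, w. repeat split; auto. apply (mul_composable _ _ _ Ht1).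
  - intros [u [t [Hu [Ht [_ Hm]]]]].
    destruct Ht as [v [w [Hv [Hw [_ Hm']]]]].
    destruct (mul_assoc_rl _ _ _ _ _ Hm' Hm) as [p [Hp1 Hp2]].
    exists p, w. repeat split; auto; [|apply (mul_composable _ _ _ Hp2)].
    exists u, v. repeat split; auto. apply (mul_composable _ _ _ Hp1).
Qed.

Lemma Omega_unit a : q_mul O (q_e O) a = a /\ q_mul O a (q_e O) = a.
Proof.
  split; apply opens_eq; intros z; rewrite Omega_mul_eq, Omega_e_eq; split.
  - intros [p [u [Hp [Hu [Hpu Hm]]]]]. unfold units in Hp. rewrite Hp in Hpu. subst p.
    rewrite (mul_unit_l _ _ Hm). auto.
  - intros Hz. exists (r z), z. repeat split; auto; apply units_idem || apply mul_units.
  - intros [u [p [Hu [Hp [Hup Hm]]]]]. rewrite (unit_of_d p Hp) in Hup. subst p.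
    rewrite (mul_unit_r _ _ Hm). auto.
  - intros Hz. exists z, (d z). repeat split; auto.
    + apply units_idem.
    + symmetry. apply units_idem.
    + apply mul_units.
Qed.

Lemma Omega_mul_lub a S j : is_lub O S j ->
  is_lub O (fun x => exists s, S s /\ x = q_mul O a s) (q_mul O a j) /\
  is_lub O (fun x => exists s, S s /\ x = q_mul O s a) (q_mul O j a).
Proof.
  intros Hj. pose proof (proj1 (Omega_lub S j) Hj) as HJ.
  split; apply Omega_lub; intros x; rewrite Omega_mul_eq; split.
  - intros [u [v [Hu [Hv [Huv Hm]]]]]. apply HJ in Hv. destruct Hv as [s [Hs Hv]].
    exists (q_mul O a s). split; [exists s; auto|]. rewrite Omega_mul_eq. exists u, v. auto.
  - intros [V [[s [Hs ->]] Hx]]. rewrite Omega_mul_eq in Hx.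
    destruct Hx as [u [v [Hu [Hv [Huv Hm]]]]].
    exists u, v. repeat split; auto. apply HJ. exists s; auto.
  - intros [u [v [Hu [Hv [Huv Hm]]]]]. apply HJ in Hu. destruct Hu as [s [Hs Hu]].
    exists (q_mul O s a). split; [exists s; auto|]. rewrite Omega_mul_eq. exists u, v. auto.
  - intros [V [[s [Hs ->]] Hx]]. rewrite Omega_mul_eq in Hx.
    destruct Hx as [u [v [Hu [Hv [Huv Hm]]]]].
    exists u, v. repeat split; auto. apply HJ. exists s; auto.
Qed.

Lemma image_op_lub (op_f : opens C -> opens C) f S j :
  (forall U, proj1_sig (op_f U) = image f (proj1_sig U)) -> is_lub O S j ->
  is_lub O (fun x => exists s, S s /\ x = op_f s) (op_f j).
Proof.
  intros Hf Hj. pose proof (proj1 (Omega_lub S j) Hj) as HJ.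
  apply Omega_lub. intros x. rewrite Hf. split.
  - intros [y [Hy ->]]. apply HJ in Hy. destruct Hy as [s [Hs Hy]].
    exists (op_f s). split; [exists s; auto|]. rewrite Hf. exists y; auto.
  - intros [V [[s [Hs ->]] Hx]]. rewrite Hf in Hx. destruct Hx as [y [Hy ->]].
    exists y. split; auto. apply HJ. exists s; auto.
Qed.

Lemma Omega_dr_lub S j : is_lub O S j ->
  is_lub O (fun x => exists s, S s /\ x = q_star O s) (q_star O j) /\
  is_lub O (fun x => exists s, S s /\ x = q_plus O s) (q_plus O j).
Proof.
  intros Hj. split; eapply image_op_lub; eauto using Omega_star_eq, Omega_plus_eq.
Qed.

Lemma Omega_dr_proj a : q_le O (q_star O a) (q_e O) /\ q_le O (q_plus O a) (q_e O).
Proof.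
  split; intros x Hx; [rewrite Omega_star_eq in Hx | rewrite Omega_plus_eq in Hx];
    rewrite Omega_e_eq; destruct Hx as [y [Hy ->]]; apply units_idem.
Qed.

Lemma proj_units (p : opens C) : q_le O p (q_e O) -> forall x, proj1_sig p x -> d x = x.
Proof. intros Hp x Hx. pose proof (Hp x Hx) as H. rewrite Omega_e_eq in H. exact H. Qed.

Lemma Omega_proj_fixed p : q_le O p (q_e O) -> q_star O p = p /\ q_plus O p = p.
Proof.
  intros Hp. pose proof (proj_units p Hp) as Hu.
  split; apply opens_eq; intros x; [rewrite Omega_star_eq | rewrite Omega_plus_eq]; split.
  - intros [y [Hy ->]]. rewrite (Hu y Hy). auto.
  - intros Hx. exists x. split; auto. symmetry; auto.
  - intros [y [Hy ->]]. rewrite (unit_of_d y (Hu y Hy)). auto.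
  - intros Hx. exists x. split; auto. symmetry; apply unit_of_d; auto.
Qed.

Lemma units_mul_inter (p q : opens C) :
  (forall x, proj1_sig p x -> d x = x) -> (forall x, proj1_sig q x -> d x = x) ->
  forall z, proj1_sig (q_mul O p q) z <-> proj1_sig p z /\ proj1_sig q z.
Proof.
  intros Hp Hq z. rewrite Omega_mul_eq. split.
  - intros [u [v [Hu [Hv [Huv Hm]]]]].
    rewrite (Hp u Hu), (unit_of_d v (Hq v Hv)) in Huv. subst v.
    rewrite <- (unit_of_d u (Hp u Hu)) in Hm at 1. rewrite (mul_unit_l _ _ Hm). auto.
  - intros [H1 H2]. exists z, z. repeat split; auto.
    + rewrite (Hp z H1), (unit_of_d z (Hp z H1)). auto.
    + pose proof (proj2 (mul_units z)) as H. rewrite (unit_of_d z (Hp z H1)) in H. auto.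
Qed.

Lemma Omega_proj_comm p q : q_le O p (q_e O) -> q_le O q (q_e O) ->
  q_le O (q_mul O p q) (q_e O) /\ q_mul O p q = q_mul O q p /\ q_mul O p p = p.
Proof.
  intros Hp Hq. pose proof (proj_units p Hp) as Hp'. pose proof (proj_units q Hq) as Hq'.
  repeat split.
  - intros z Hz. apply (units_mul_inter p q Hp' Hq') in Hz. apply Hp, Hz.
  - apply opens_eq. intros z. rewrite (units_mul_inter p q), (units_mul_inter q p); tauto.
  - apply opens_eq. intros z. rewrite (units_mul_inter p p); tauto.
Qed.

Lemma Omega_restr a : q_mul O a (q_star O a) = a /\ q_mul O (q_plus O a) a = a.
Proof.
  split; apply opens_eq; intros z; rewrite Omega_mul_eq;
    [rewrite Omega_star_eq | rewrite Omega_plus_eq]; split.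
  - intros [u [p [Hu [[x [Hx ->]] [Hup Hm]]]]]. rewrite (proj1 (proj2 (units_idem x))) in Hup.
    rewrite <- Hup in Hm. rewrite (mul_unit_r _ _ Hm). auto.
  - intros Hz. exists z, (d z). repeat split; [auto | exists z; auto | |].
    + symmetry. apply units_idem.
    + apply mul_units.
  - intros [p [u [[x [Hx ->]] [Hu [Hpu Hm]]]]].
    rewrite (proj1 (proj2 (proj2 (units_idem x)))) in Hpu.
    rewrite Hpu in Hm. rewrite (mul_unit_l _ _ Hm). auto.
  - intros Hz. exists (r z), z. repeat split; [exists z; auto | auto | |].
    + apply units_idem.
    + apply mul_units.
Qed.

Lemma Omega_dr_mul a b : q_star O (q_mul O a b) = q_star O (q_mul O (q_star O a) b) /\
  q_plus O (q_mul O a b) = q_plus O (q_mul O a (q_plus O b)).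
Proof.
  split; apply opens_eq; intros y; [rewrite !Omega_star_eq | rewrite !Omega_plus_eq]; split.
  - intros [z [Hz ->]]. rewrite Omega_mul_eq in Hz. destruct Hz as [u [v [Hu [Hv [Huv Hm]]]]].
    exists v. split; [|apply (mul_d_r _ _ _ Hm)].
    rewrite Omega_mul_eq. exists (d u), v. repeat split; auto.
    + rewrite Omega_star_eq. exists u; auto.
    + rewrite (proj1 (units_idem u)). auto.
    + rewrite Huv. apply mul_units.
  - intros [z [Hz ->]]. rewrite Omega_mul_eq in Hz. destruct Hz as [p [v [Hp [Hv [Hpv Hm]]]]].
    rewrite Omega_star_eq in Hp. destruct Hp as [u [Hu ->]].
    rewrite (proj1 (units_idem u)) in Hpv. rewrite Hpv in Hm. rewrite (mul_unit_l _ _ Hm).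
    destruct (mul_exists u v Hpv) as [w Hw]. exists w. split.
    + rewrite Omega_mul_eq. exists u, v. auto.
    + symmetry. apply (mul_d_r _ _ _ Hw).
  - intros [z [Hz ->]]. rewrite Omega_mul_eq in Hz. destruct Hz as [u [v [Hu [Hv [Huv Hm]]]]].
    exists u. split; [|apply (mul_d_r _ _ _ Hm)].
    rewrite Omega_mul_eq. exists u, (r v). repeat split; auto.
    + rewrite Omega_plus_eq. exists v; auto.
    + rewrite (proj2 (proj2 (proj2 (units_idem v)))). auto.
    + rewrite <- Huv. apply mul_units.
  - intros [z [Hz ->]]. rewrite Omega_mul_eq in Hz. destruct Hz as [u [p [Hu [Hp [Hup Hm]]]]].
    rewrite Omega_plus_eq in Hp. destruct Hp as [v [Hv ->]].
    rewrite (proj2 (proj2 (proj2 (units_idem v)))) in Hup.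
    rewrite <- Hup in Hm. rewrite (mul_unit_r _ _ Hm).
    destruct (mul_exists u v Hup) as [w Hw]. exists w. split.
    + rewrite Omega_mul_eq. exists u, v. auto.
    + symmetry. apply (mul_d_r _ _ _ Hw).
Qed.

Lemma Omega_restriction_frame : restriction_frame O.
Proof.
  constructor.
  - intros a x; auto.
  - intros a b c H1 H2 x Hx; auto.
  - apply Omega_antisym.
  - apply Omega_lub_exists.
  - apply Omega_distr.
  - apply Omega_assoc.
  - apply Omega_unit.
  - apply Omega_mul_lub.
  - apply Omega_dr_lub.
  - apply Omega_dr_proj.
  - apply Omega_proj_fixed.
  - apply Omega_proj_comm.
  - apply Omega_restr.
  - apply Omega_dr_mul.
Qed.

Definition bisection (U : opens C) : Prop :=
  (forall x y, proj1_sig U x -> proj1_sig U y -> d x = d y -> x = y) /\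
  (forall x y, proj1_sig U x -> proj1_sig U y -> r x = r y -> x = y).

Lemma bisection_partial_isometry a : bisection a -> partial_isometry O a.
Proof.
  intros [Hd Hr] b Hb.
  split; apply opens_eq; intros z; rewrite Omega_mul_eq;
    [rewrite Omega_plus_eq | rewrite Omega_star_eq]; split.
  - intros Hz. exists (r z), z. repeat split; [exists z; auto | apply Hb; auto | |].
    + apply units_idem.
    + apply mul_units.
  - intros [p [u [[v [Hv ->]] [Hu [Hpu Hm]]]]].
    rewrite (proj1 (proj2 (proj2 (units_idem v)))) in Hpu.
    assert (E : v = u) by (apply Hr; auto). subst u.
    rewrite (mul_unit_l _ _ Hm). auto.
  - intros Hz. exists z, (d z). repeat split; [apply Hb; auto | exists z; auto | |].
    + symmetry. apply units_idem.
    + apply mul_units.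
  - intros [u [p [Hu [[v [Hv ->]] [Hup Hm]]]]].
    rewrite (proj1 (proj2 (units_idem v))) in Hup.
    assert (E : u = v) by (apply Hd; auto). subst u.
    rewrite (mul_unit_r _ _ Hm). auto.
Qed.

Lemma bisection_down a b : bisection a -> q_le O b a -> bisection b.
Proof. intros [Hd Hr] Hb. split; intros x y Hx Hy H; [apply Hd | apply Hr]; auto. Qed.

Lemma bisection_mul a b : bisection a -> bisection b -> bisection (q_mul O a b).
Proof.
  intros [Hda Hra] [Hdb Hrb]. split; intros w w'; rewrite Omega_mul_eq;
    intros [u [v [Hu [Hv [Huv Hm]]]]] [u' [v' [Hu' [Hv' [Huv' Hm']]]]] H.
  - rewrite (proj1 (mul_d_r _ _ _ Hm)), (proj1 (mul_d_r _ _ _ Hm')) in H.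
    assert (E : v = v') by auto. subst v'.
    assert (E : u = u') by (apply Hda; auto; congruence). subst u'.
    apply (mul_unique _ _ _ _ Hm Hm').
  - rewrite (proj2 (mul_d_r _ _ _ Hm)), (proj2 (mul_d_r _ _ _ Hm')) in H.
    assert (E : u = u') by auto. subst u'.
    assert (E : v = v') by (apply Hrb; auto; congruence). subst v'.
    apply (mul_unique _ _ _ _ Hm Hm').
Qed.

(* Since d and r are local homeomorphisms, every arrow lies in an open bisection. *)
Lemma bisections_cover t : (forall x, q_le O x t) -> is_lub O bisection t.
Proof.
  destruct HC as [_ [_ [_ [_ [Hdl Hrl]]]]].
  intros Ht. apply Omega_lub. intros x. split.
  - intros _. destruct (proj2 Hdl x) as [W1 [HW1 [W1x [W1i _]]]].
    destruct (proj2 Hrl x) as [W2 [HW2 [W2x [W2i _]]]].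
    exists (exist _ _ (open_inter _ _ HW1 HW2)). simpl. split; [|auto].
    split; simpl; intros y z [Hy1 Hy2] [Hz1 Hz2] H; auto.
  - intros _. apply (Ht full_open). simpl. auto.
Qed.

Lemma Omega_bisection_base : frame_base O bisection.
Proof.
  constructor; [exact bisection_partial_isometry | exact bisection_down |
                exact bisection_mul | exact bisections_cover].
Qed.

(* Omega(C) is spatial: its opens are separated by the neighbourhood filters. *)
Lemma Omega_spatial : spatial O.
Proof.
  apply (spatial_of_enough_points O Omega_restriction_frame bisection Omega_bisection_base).
  intros a b H x Hx. exact (H (exist _ _ (nbhd_cpfilter x)) Hx).
Qed.

End Etale.

Theorem mainTheorem17 :
  (forall C : TopCat, is_etale C -> spatial (Omega C)) /\
  (forall Q : QF, is_RQF Q -> sober (Ccat Q)).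
Proof.
  split.
  - exact Omega_spatial.
  - intros Q HQ.
    exact (Ccat_sober Q (RQF_restriction_frame Q HQ) (partial_isometry Q)
             (RQF_partial_isometry_base Q HQ)).
Qed.
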